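(* Let $N\ge 3$, let $I_1,I_2,l,I_3,\dots,I_N$ be positive integers, and let $\mathcal{A}\in\mathbb{C}^{I_1\times l\times I_3\times\cdots\times I_N}$ and $\mathcal{B}\in\mathbb{C}^{l\times I_2\times I_3\times\cdots\times I_N}$. Then the generalized c-product of $\mathcal{A}$ and $\mathcal{B}$ can be computed in the cosine domain: $$\mathcal{A}*_c\mathcal{B}=\mathcal{L}^{-1}\left(\mathcal{L}(\mathcal{A})\,\triangle\,\mathcal{L}(\mathcal{B})\right).$$
   Context: DCT matrix: $C_n\in\mathbb{R}^{n\times n}$ has entries $(C_n)_{i,j}=\sqrt{\frac{2-\delta_{i,1}}{n}}\cos\left(\frac{(i-1)(2j-1)\pi}{2n}\right)$, $1\le i,j\le n$. $W_n=\mathrm{diag}(C_n(:,1))$ is the diagonal matrix whose diagonal is the first column of $C_n$; $Z_n$ is the $n\times n$ matrix with ones on the first superdiagonal and zeros elsewhere; $M_n=W_n^{-1}C_n(I_n+Z_n)$, with $I_n$ the identity matrix. $n$-mode product: for $U\in\mathbb{C}^{J\times I_n}$, $(\mathcal{X}\times_n U)_{i_1,\dots,i_{n-1},j,i_{n+1},\dots,i_N}=\sum_{i_n}\mathcal{X}_{i_1,\dots,i_N}U_{j,i_n}$. The operator $\mathcal{L}$ (on tensors with last dimensions $I_3,\dots,I_N$ and any first two dimensions) is $\mathcal{L}(\mathcal{A})=\mathcal{A}\times_3 M_{I_3}\times_4\cdots\times_N M_{I_N}$, with inverse $\mathcal{L}^{-1}(\mathcal{A})=\mathcal{A}\times_N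 M_{I_N}^{-1}\times_{N-1}\cdots\times_3 M_{I_3}^{-1}$. Block-Toeplitz-plus-Hankel matrix, defined recursively: for a matrix $A$ (order 2 tensor) $\mathrm{btph}(A)=A$. For a tensor $\mathcal{X}$ of order $N\ge 3$ with last dimension $n=I_N$, put $\mathcal{X}_k=\mathcal{X}(:,\dots,:,k)$; then $\mathrm{btph}(\mathcal{X})$ is the $n\times n$ block matrix whose $(i,j)$ block is $\mathrm{btph}(\mathcal{X}_{|i-j|+1})+H_{ij}$, where $H_{ij}=\mathrm{btph}(\mathcal{X}_{i+j})$ if $i+j\le n$, $H_{ij}=0$ if $i+j=n+1$, and $H_{ij}=\mathrm{btph}(\mathcal{X}_{2n+2-i-j})$ if $i+j\ge n+2$. The operator $\mathrm{ten}$ reconstructs a tensor from its btph matrix: $\mathrm{ten}(\mathrm{btph}(\mathcal{X}))=\mathcal{X}$. Generalized c-product: $\mathcal{A}*_c\mathcal{B}=\mathrm{ten}\left(\mathrm{btph}(\mathcal{A})\,\mathrm{btph}(\mathcal{B})\right)\in\mathbb{C}^{I_1\times I_2\times I_3\times\cdots\times I_N}$, i.e. the tensor whose btph matrix is $\mathrm{btph}(\mathcal{A})\,\mathrm{btph}(\mathcal{B})$. Face-wise product: $\mathcal{C}=\mathcal{A}\triangle\mathcal{B}$ is defined by $\mathcal{C}(:,:,k_3,\dots,k_N)=\mathcal{A}(:,:,k_3,\dots,k_N)\,\mathcal{B}(:,:,k_3,\dots,k_N)$ (matrix product) for all $k_3,\dots,k_N$. *)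

(* Defs.v *)
From HB Require Import structures.
From mathcomp Require Import all_boot all_order all_algebra complex.
From mathcomp Require Import boolp reals trigo.

Set Implicit Arguments.
Unset Strict Implicit.
Unset Printing Implicit Defensive.

Import Order.TTheory GRing.Theory Num.Theory.
Local Open Scope ring_scope.
Local Open Scope complex_scope.

(* A tensor of order r.+2 is the family of its frontal slices
   X(:, :, k_3, ..., k_N), with N = r.+2.  All indices are 0-based, so that
   k : 'I_r stands for mode k + 3, of dimension d k, and an index x : 'I_n
   stands for the 1-based index x + 1. *)
Definition mindex (r : nat) (d : 'I_r -> nat) : Type := forall k : 'I_r, 'I_(d k).

Definition tensor (K : Type) (m p r : nat) (d : 'I_r -> nat) : Type :=
  mindex d -> 'M[K]_(m, p).

(* Mode k + 3 product with a square matrix, which keeps the dimensions;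
   [dfwith i x] is the multi-index i with its k-th entry replaced by x. *)
Definition mode_prod (K : pzRingType) (m p r : nat) (d : 'I_r -> nat) (k : 'I_r)
    (U : 'M[K]_(d k)) (X : tensor K m p d) : tensor K m p d :=
  fun i => \sum_(x < d k) U (i k) x *: X (dfwith i x).

Definition facewise (K : pzRingType) (m l p r : nat) (d : 'I_r -> nat)
    (A : tensor K m l d) (B : tensor K l p d) : tensor K m p d :=
  fun i => A i *m B i.

Definition dct (R : realType) (n : nat) : 'M[R]_n :=
  \matrix_(i < n, j < n)
    (Num.sqrt ((2 - (i == 0%N :> nat)%:R) / n%:R)
     * cos (i%:R * (2 * j%:R + 1) * pi / (2 * n%:R))).

Definition dct_diag (R : realType) (n : nat) : 'M[R]_n :=
  match n return 'M[R]_n with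
  | 0 => 0
  | n'.+1 => diag_mx (col ord0 (dct R n'.+1))^T
  end.

Definition superdiag (R : realType) (n : nat) : 'M[R]_n :=
  \matrix_(i < n, j < n) (j == i.+1 :> nat)%:R.

Definition cosmx (R : realType) (n : nat) : 'M[R]_n :=
  invmx (dct_diag R n) *m dct R n *m (1%:M + superdiag R n).

Definition cosmxC (R : realType) (n : nat) : 'M[R[i]]_n :=
  map_mx (fun x : R => x%:C) (cosmx R n).

Definition Lop (R : realType) (m p r : nat) (d : 'I_r -> nat)
    (X : tensor R[i] m p d) : tensor R[i] m p d :=
  foldl (fun Y k => mode_prod (cosmxC R (d k)) Y) X (enum 'I_r).

Definition Linv (R : realType) (m p r : nat) (d : 'I_r -> nat)
    (X : tensor R[i] m p d) : tensor R[i] m p d :=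
  foldl (fun Y k => mode_prod (invmx (cosmxC R (d k))) Y) X (rev (enum 'I_r)).

Definition dims_init (r : nat) (d : 'I_r.+1 -> nat) : 'I_r -> nat :=
  fun k => d (lift ord_max k).

Definition mindex_nil (d : 'I_0 -> nat) : mindex d :=
  fun k => let: Ordinal _ lt_k0 := k in False_rect _ (notF lt_k0).

(* The multi-index (i, x): see mindex_rcons_lift and mindex_rcons_max. *)
Definition mindex_rcons (r : nat) (d : 'I_r.+1 -> nat)
    (i : mindex (dims_init d)) (x : 'I_(d ord_max)) : mindex d :=
  fun k => match unliftP ord_max k with
           | UnliftSome j def_k => cast_ord (congr1 d (esym def_k)) (i j)
           | UnliftNone def_k => cast_ord (congr1 d (esym def_k)) x
           end.

Lemma mindex_rcons_lift (r : nat) (d : 'I_r.+1 -> nat)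
    (i : mindex (dims_init d)) (x : 'I_(d ord_max)) (k : 'I_r) :
  mindex_rcons i x (lift ord_max k) = i k.
Proof.
rewrite /mindex_rcons; case: unliftP => [j e|e]; last first.
  by case/eqP: (neq_lift ord_max k); rewrite e.
have ekj := lift_inj e; move: e; rewrite -ekj => e.
by apply: val_inj.
Qed.

Lemma mindex_rcons_max (r : nat) (d : 'I_r.+1 -> nat)
    (i : mindex (dims_init d)) (x : 'I_(d ord_max)) :
  mindex_rcons i x ord_max = x.
Proof.
rewrite /mindex_rcons; case: unliftP => [j e|e]; last exact: val_inj.
by case/eqP: (neq_lift ord_max j).
Qed.

Definition last_slice (K : Type) (m p r : nat) (d : 'I_r.+1 -> nat)
    (X : tensor K m p d) (x : 'I_(d ord_max)) : tensor K m p (dims_init d) :=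
  fun i => X (mindex_rcons i x).

Definition nth_ord (V : nmodType) (n : nat) (F : 'I_n -> V) (k : nat) : V :=
  oapp F 0 (insub k).

(* Block (i, j) of the Toeplitz-plus-Hankel array built on F.  In 1-based terms
   (i' = i + 1, j' = j + 1), F_k is nth_ord F (k - 1) and the three cases are
   i' + j' <= n, i' + j' = n + 1 and i' + j' >= n + 2. *)
Definition tph (V : nmodType) (n : nat) (F : 'I_n -> V) (i j : 'I_n) : V :=
  nth_ord F `|i%:Z - j%:Z|%N +
  (if (i + j + 2 <= n)%N then nth_ord F (i + j + 1)%N
   else if (i + j + 2 == n + 1)%N then 0
   else nth_ord F (2 * n - (i + j + 1))%N).

(* bdim m d is m times the product of the d k, in the form of an iterated sum,
   as in the type of \mxblock. *)
Fixpoint bdim (m r : nat) : ('I_r -> nat) -> nat :=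
  match r return ('I_r -> nat) -> nat with
  | 0 => fun _ => m
  | r'.+1 => fun d => (\sum_(i < d ord_max) bdim m (dims_init d))%N
  end.

Fixpoint btph (K : nmodType) (m p r : nat) :
    forall d : 'I_r -> nat, tensor K m p d -> 'M[K]_(bdim m d, bdim p d) :=
  match r return forall d : 'I_r -> nat,
      tensor K m p d -> 'M[K]_(bdim m d, bdim p d) with
  | 0 => fun d X => X (mindex_nil d)
  | r'.+1 => fun d X =>
      \mxblock_(i < d ord_max, j < d ord_max)
        tph (fun k => btph (last_slice X k)) i j
  end.

(* ten M is the tensor X such that btph X = M; it is unique by btph_inj.
   The value 0 is a default for the M that are not of the form btph X. *)
Definition ten (K : nmodType) (m p r : nat) (d : 'I_r -> nat)
    (M : 'M[K]_(bdim m d, bdim p d)) : tensor K m p d :=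
  if pselect (exists X : tensor K m p d, btph X = M) is left exX
  then sval (cid exX) else fun=> 0.

Definition cprod (K : pzRingType) (m l p r : nat) (d : 'I_r -> nat)
    (A : tensor K m l d) (B : tensor K l p d) : tensor K m p d :=
  ten (btph A *m btph B).

Lemma nth_ordE (V : nmodType) (n : nat) (F : 'I_n -> V) (k : 'I_n) :
  nth_ord F k = F k.
Proof. by rewrite /nth_ord valK. Qed.

Lemma tph_inj (V : zmodType) (n : nat) (F G : 'I_n -> V) :
  (forall i j, tph F i j = tph G i j) -> F =1 G.
Proof.
case: n F G => [|n] F G eqFG; first by case.
suff nthFG s k : (n - k < s)%N -> (k <= n)%N -> nth_ord F k = nth_ord G k.
  move=> k; rewrite -(nth_ordE F k) -(nth_ordE G k).
  by apply: (nthFG n.+1); rewrite ?ltnS ?leq_subr // -ltnS.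
elim: s k => // s IHs k lt_nk_s le_kn.
have := eqFG ord0 (inord k); rewrite /tph !inordK ?ltnS //= add0n !addn1 addn2.
rewrite sub0r abszN absz_nat !ltnS.
case: ltnP => [lt_kn|le_nk].
  by rewrite (IHs k.+1) ?subnS //; [move/addIr | rewrite -ltnS prednK ?subn_gt0].
have -> : k = n by apply/eqP; rewrite eqn_leq le_kn.
by rewrite eqxx !addr0.
Qed.

Lemma btph_inj (K : zmodType) (m p r : nat) (d : 'I_r -> nat) :
  injective (@btph K m p r d).
Proof.
elim: r d => [|r IHr] d X Y.
  move=> /= eqXY; apply: functional_extensionality_dep => i.
  suff -> : i = mindex_nil d by [].
  by apply: functional_extensionality_dep; case.
move=> /= /eq_mxblockP/tph_inj eqXY; apply: functional_extensionality_dep => i.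
have -> : i = mindex_rcons (fun k => i (lift ord_max k)) (i ord_max).
  apply: functional_extensionality_dep => k.
  case: (unliftP ord_max k) => [j ->|->].
    by rewrite mindex_rcons_lift.
  by rewrite mindex_rcons_max.
by have /(congr1 (fun Z => Z (fun k => i (lift ord_max k)))) := IHr _ _ _ (eqXY (i ord_max)).
Qed.

Lemma ten_btph (K : zmodType) (m p r : nat) (d : 'I_r -> nat)
    (X : tensor K m p d) : ten (btph X) = X.
Proof.
rewrite /ten; case: pselect => [exX|[]]; last by exists X.
by case: cid => /= Y /btph_inj.
Qed.

(* Main.v *)
(* Row i of the DCT matrix is, up to a scalar, the wave
   a |-> cos((2a+1) i pi / 2n), which is even about -1/2 and about n - 1/2.
   These two symmetries make it a left eigenvector of every n x n
   Toeplitz-plus-Hankel array built on a family F, with eigenvalue the i-th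
   entry of M_n F; the identity also holds when F takes values in a module, so
   it applies to block arrays.  Hence one level of btph multiplies through
   M_n F, and the theorem follows by induction on the number of modes, each
   level being linear in the family of its blocks. *)
Require Import Defs.
From mathcomp Require Import all_boot all_order all_algebra complex.
From mathcomp Require Import boolp reals trigo.
From mathcomp Require Import zify ring lra.

Set Implicit Arguments.
Unset Strict Implicit.
Unset Printing Implicit Defensive.

Import Order.TTheory GRing.Theory Num.Theory.
Local Open Scope ring_scope.
Local Open Scope complex_scope.

(** * Toeplitz-plus-Hankel arrays as weighted sums of their family *)

Lemma nth_ord_delta (V : nmodType) (n : nat) (F : 'I_n -> V) (k : nat) :
  nth_ord F k = \sum_x F x *+ (k == x).
Proof.
rewrite /nth_ord; case: insubP => [u lt_u <-|Nlt] /=.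
  rewrite (bigD1 u) //= eqxx big1 ?addr0 // => x neq_xu.
  by rewrite (_ : (_ == _) = false) //; apply/negbTE; rewrite eq_sym.
by rewrite big1 // => x _; case: eqP => // e; move: Nlt; rewrite e ltn_ord.
Qed.

(** Solving the index equations of [tph] for [a], with [b] and [x] fixed, gives [b + x] and [b - x],
    each replaced by its mirror image when it leaves [0, n). For [x = 0] the two solutions coincide
    and count once. *)
Lemma tph_delta (V : nmodType) (n : nat) (F : 'I_n -> V) (a b : 'I_n) :
  tph F a b = \sum_x F x *+ (if x == 0%N :> nat then (a == b :> nat) : nat else
    (a == (if b + x < n then b + x else (2 * n - x - b).-1) :> nat)%N
    + (a == (if x <= b then b - x else (x - b).-1) :> nat)%N)%N.
Proof.
have lta := ltn_ord a; have ltb := ltn_ord b.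
(* Both Hankel indices can be kept at once: the one not selected by [tph] is at least [n], and both
   equal [n] on the zero antidiagonal, so they match no [x]. *)
transitivity (\sum_x F x *+ (((`|a%:Z - b%:Z|%N == x) : nat)
   + (((a + b + 1 == x) : nat) + ((2 * n - (a + b + 1) == x) : nat)))%N).
  have outside k : (n <= k)%N -> forall x : 'I_n, (k == x) = false.
    by move=> le_nk x; rewrite gtn_eqF ?(leq_trans (ltn_ord x)).
  have addE k : \sum_x F x *+ (`|a%:Z - b%:Z|%N == x) + nth_ord F k
     = \sum_x F x *+ ((`|a%:Z - b%:Z|%N == x) + (k == x))%N.
    by rewrite nth_ord_delta -big_split; apply: eq_bigr => x _; rewrite mulrnDr.
  rewrite /tph [nth_ord F `|_|%N]nth_ord_delta.
  have [h1|h1] := leqP; last have [h2|h2] := eqVneq.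
  - rewrite addE; apply: eq_bigr => x _.
    by rewrite (outside (2 * n - _)%N) ?addn0 //; lia.
  - rewrite addr0; apply: eq_bigr => x _.
    rewrite (outside (2 * n - _)%N) ?(outside (_ + 1)%N) ?addn0 //; lia.
  rewrite addE; apply: eq_bigr => x _.
  by rewrite (outside (a + b + 1)%N) //; lia.
apply: eq_bigr => x _; congr (_ *+ _); have ltx := ltn_ord x.
have [x0|x0] := eqVneq (x : nat) 0%N.
  rewrite x0 distn_eq0 (_ : (_ + 1 == 0)%N = false) ?addn1 // subn_eq0.
  by rewrite (_ : (_ <= _)%N = false) ?addn0 //; apply/negbTE; lia.
have -> : (`|a%:Z - b%:Z|%N == x)
    = ((a == b + x :> nat) + (a + x == b)%N)%N :> nat.
  have [le_ab|lt_ba] := leqP a b.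
    rewrite distnEr // (_ : (a == _ :> nat) = false) ?add0n;
      last by apply/eqP; lia.
    by congr nat_of_bool; apply/eqP/eqP; lia.
  rewrite distnEl 1?ltnW // (_ : (a + x == b)%N = false) ?addn0;
    last by apply/eqP; lia.
  by congr nat_of_bool; apply/eqP/eqP; lia.
(* Each Toeplitz solution is paired with its own reflection: [b + x] about n - 1/2, then [b - x]
   about -1/2. *)
rewrite [X in (_ + X)%N]addnC addnACA; congr addn.
  case: ltnP => h.
    rewrite (_ : (_ - _ == x)%N = false) ?addn0 //; apply/eqP; lia.
  rewrite (_ : (a == (b + x)%N :> nat) = false) ?add0n; last by apply/eqP; lia.
  by congr nat_of_bool; apply/eqP/eqP; lia.
case: leqP => h.
  rewrite (_ : (a + b + 1 == x)%N = false); last by apply/eqP; lia.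
  by rewrite addn0; congr nat_of_bool; apply/eqP/eqP; lia.
rewrite (_ : (a + x == b)%N = false); last by apply/eqP; lia.
by congr nat_of_bool; apply/eqP/eqP; lia.
Qed.

(* The weight of F x adds up c at b + x and b - x, folded back into [0, n) by
   the reflections about n - 1/2 and -1/2. *)
Lemma tph_col_sum (K : pzRingType) (V : lmodType K) (n : nat) (c : nat -> K)
    (F : 'I_n -> V) (b : 'I_n) :
  \sum_(a < n) c a *: tph F a b = \sum_(x < n)
    (if x == 0%N :> nat then c b else
     c (if b + x < n then b + x else (2 * n - x - b).-1)%N
     + c (if x <= b then b - x else (x - b).-1)%N) *: F x.
Proof.
have pick k (v : V) : (k < n)%N ->
    \sum_(a < n) (c a *: v) *+ (a == k :> nat) = c k *: v.
  move=> lt_kn; rewrite (bigD1 (Ordinal lt_kn)) //= eqxx big1 ?addr0 // => a ?.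
  by rewrite (_ : (_ == _) = false) //; apply/negbTE.
under eq_bigr do rewrite tph_delta scaler_sumr.
rewrite exchange_big; apply: eq_bigr => x _.
have ltx := ltn_ord x; have ltb := ltn_ord b.
case: eqP => [x0|x0].
  by under eq_bigr do rewrite -scalerMnr; rewrite pick.
under eq_bigr do rewrite -scalerMnr mulrnDr.
rewrite big_split scalerDl !pick //=; case: ifP; lia.
Qed.

Lemma tph_sym (V : nmodType) (n : nat) (F : 'I_n -> V) (a b : 'I_n) :
  tph F a b = tph F b a.
Proof. by rewrite /tph (addnC a b) distnC. Qed.

(** * Cosine waves: eigenvector relation and orthogonality *)

Definition freq (R : realType) (n i : nat) : R := i%:R * pi / (2 * n%:R).

Definition wave (R : realType) (n i a : nat) : R :=
  cos ((2 * a%:R + 1) * freq R n i).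

(** The eigenvalue of wave [i] on the array whose family is 1 at [x] and 0 elsewhere. At [x = 0]
    that array is the identity, whence 1 instead of 2. *)
Definition eigval (R : realType) (n i x : nat) : R :=
  if x == 0%N then 1 else 2 * cos (2 * x%:R * freq R n i).

Lemma cosDB (R : realType) (x y : R) :
  cos (x + y) + cos (x - y) = 2 * cos x * cos y.
Proof. by rewrite cosD cosB; ring. Qed.

Lemma cos_reflect (R : realType) (i : nat) (x : R) :
  cos (2 * i%:R * pi - x) = cos x.
Proof.
rewrite -(cosN x) addrC.
elim: i => [|i IHi]; first by rewrite mulr0 mul0r addr0.
by rewrite -IHi -[RHS]cosD2pi; congr cos; rewrite -natr1 mulr2n; ring.
Qed.

(** Folding an index back into [0, n) leaves the value of the wave unchanged, so the sum is that of
    cosines at [b + x] and [b - x], which [cosDB] turns into a product. *)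
Lemma wave_fold (R : realType) (n i x b : nat) : (x < n)%N -> (b < n)%N ->
  (if x == 0%N then wave R n i b else
   wave R n i (if b + x < n then b + x else (2 * n - x - b).-1)%N
   + wave R n i (if x <= b then b - x else (x - b).-1)%N)
  = wave R n i b * eigval R n i x.
Proof.
move=> ltx ltb; rewrite /eigval; case: eqP => [_|x0]; first by rewrite mulr1.
have n0 : n%:R != 0 :> R by rewrite pnatr_eq0; lia.
rewrite mulrCA mulrA -cosDB; congr (_ + _); rewrite /wave.
  case: ltnP => h; first by congr cos; rewrite natrD; ring.
  (* Reflecting the index about n - 1/2 replaces the argument t by 2 i pi - t. *)
  rewrite -(cos_reflect i); congr cos; rewrite /freq.
  have -> : ((2 * n - x - b).-1)%:R = 2 * n%:R - x%:R - b%:R - 1 :> R.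
    rewrite -[2]/(2%:R) -[1]/(1%:R) -natrM -!natrB; try lia.
    by congr (_%:R); lia.
  by field.
case: leqP => h; first by congr cos; rewrite natrB //; ring.
(* Reflecting the index about -1/2 changes the sign of the argument. *)
rewrite -cosN; congr cos.
have -> : ((x - b).-1)%:R = x%:R - b%:R - 1 :> R.
  rewrite -[1]/(1%:R) -!natrB; try lia.
  by congr (_%:R); lia.
ring.
Qed.

(** The morphism [f] carries the real waves to the scalars of the blocks, later the complex numbers;
    [V] will be a space of matrices. *)
Lemma wave_eig (R : realType) (K : pzRingType) (f : {rmorphism R -> K})
    (n i : nat) (V : lmodType K) (F : 'I_n -> V) (b : 'I_n) :
  \sum_(a < n) f (wave R n i a) *: tph F a b
  = f (wave R n i b) *: \sum_(x < n) f (eigval R n i x) *: F x.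
Proof.
rewrite (tph_col_sum (fun a => f (wave R n i a))) scaler_sumr.
apply: eq_bigr => x _; rewrite scalerA -rmorphM -wave_fold //.
by case: eqP => // _; rewrite rmorphD.
Qed.

Lemma freq_bounds (R : realType) (n i : nat) :
  (i < n)%N -> 0 <= freq R n i < pi / 2.
Proof.
move=> lt_in; rewrite /freq.
have n0 : 0 < n%:R :> R by rewrite ltr0n; lia.
have pi0 := pi_gt0 R.
apply/andP; split.
  by rewrite divr_ge0 ?mulr_ge0 ?ler0n //; lra.
have -> : pi / 2 = n%:R * pi / (2 * n%:R) :> R.
  by field; rewrite gt_eqF.
by rewrite !ltr_pM2r ?ltr_nat // invr_gt0; lra.
Qed.

Lemma wave0_gt0 (R : realType) (n i : nat) : (i < n)%N -> 0 < wave R n i 0.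
Proof.
move=> /(freq_bounds R)/andP[f0 f1]; rewrite /wave mulr0 add0r mul1r.
by apply: cos_gt0_pihalf; rewrite f1 andbT; have := pi_gt0 R; lra.
Qed.

(* Distinct waves are eigenvectors of the symmetric matrix [tph delta_1] for
   distinct eigenvalues. *)
Lemma wave_orth (R : realType) (n i j : nat) :
  (i < n)%N -> (j < n)%N -> i != j ->
  \sum_(a < n) wave R n i a * wave R n j a = 0.
Proof.
move=> lt_in lt_jn neq_ij.
have lt1n : (1 < n)%N by lia.
pose F (x : 'I_n) : R^o := (x == Ordinal lt1n)%:R.
have eigF k : \sum_(x < n) eigval R n k x *: F x = eigval R n k 1.
  rewrite (bigD1 (Ordinal lt1n)) //= big1 ?addr0 /F ?eqxx; first exact: mulr1.
  by move=> x /negbTE->; rewrite scaler0.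
have eqS : eigval R n i 1 * (\sum_(a < n) wave R n i a * wave R n j a)
    = eigval R n j 1 * (\sum_(a < n) wave R n i a * wave R n j a).
  transitivity (\sum_(b < n) \sum_(a < n)
    wave R n i a * wave R n j b * tph F a b).
    rewrite mulr_sumr; apply: eq_bigr => b _.
    under eq_bigr do rewrite mulrAC.
    rewrite -[RHS]mulr_suml; have := wave_eig idfun i F b; rewrite eigF => H.
    rewrite [X in _ = X * _]H; rewrite /GRing.scale /=; ring.
  rewrite exchange_big mulr_sumr; apply: eq_bigr => a _.
  under eq_bigr do rewrite -mulrA tph_sym.
  rewrite -[LHS]mulr_sumr; have := wave_eig idfun j F a; rewrite eigF => H.
  rewrite [X in _ * X = _]H; rewrite /GRing.scale /=; ring.
move/eqP: eqS; rewrite -subr_eq0 -mulrBl mulf_eq0 => /orP[|/eqP//].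
(* If the eigenvalues agree, so do the cosines of twice the frequencies. These angles lie in [0,
   pi), where cos is injective, which forces [i = j]. *)
rewrite subr_eq0 /eigval /= => /eqP/(mulfI _) E.
have {E} /cos_inj E := E (ltac:(by rewrite pnatr_eq0)).
case/eqP: neq_ij.
have n0 : 0 < n%:R :> R by rewrite ltr0n; lia.
have pi0 := pi_gt0 R.
have /andP[f1 f2] := freq_bounds R lt_in.
have /andP[f3 f4] := freq_bounds R lt_jn.
have : freq R n i = freq R n j.
  by apply: (mulfI (_ : 2 * 1 != 0)); [lra | apply: E; rewrite in_itv /=; lra].
rewrite /freq => /mulIf/mulIf/eqP; rewrite eqr_nat => H; apply/eqP/H.
  by rewrite gt_eqF.
by rewrite invr_eq0 mulf_eq0; lra.
Qed.

(** * Invertibility of the DCT matrix and entries of M_n *)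

Definition dct_scale (R : realType) (n i : nat) : R :=
  Num.sqrt ((2 - (i == 0%N)%:R) / n%:R).

Lemma dct_scale_gt0 (R : realType) (n i : nat) :
  (0 < n)%N -> 0 < dct_scale R n i.
Proof.
move=> n0; rewrite sqrtr_gt0 divr_gt0 ?ltr0n //.
by case: (i == 0)%N; rewrite /=; lra.
Qed.

Lemma dctE (R : realType) (n : nat) (i j : 'I_n) :
  dct R n i j = dct_scale R n i * wave R n i j.
Proof. by rewrite mxE /wave /freq; congr (_ * cos _); ring. Qed.

(** The product C_n C_n^T is diagonal by [wave_orth], and its diagonal is positive because every row
    of C_n starts with a positive entry. *)
Lemma dct_unit (R : realType) (n : nat) : dct R n \in unitmx.
Proof.
pose d := \row_(i < n) \sum_j dct R n i j ^+ 2.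
have dctdct : dct R n *m (dct R n)^T = diag_mx d.
  apply/matrixP => i j; rewrite !mxE.
  under eq_bigr do rewrite [_^T _ _]mxE.
  have [<-|neq_ij] := eqVneq i j; first by [].
  under eq_bigr do rewrite !dctE mulrACA.
  by rewrite -mulr_sumr wave_orth // mulr0.
have : dct R n *m (dct R n)^T \in unitmx.
  rewrite dctdct unitmxE det_diag unitfE; apply/prodf_neq0 => i _.
  have n0 := leq_ltn_trans (leq0n i) (ltn_ord i).
  rewrite mxE gt_eqF // (bigD1 (Ordinal n0)) //=.
  rewrite ltr_wpDr ?sumr_ge0 // => [j _|].
    exact: sqr_ge0.
  by rewrite exprn_gt0 // dctE mulr_gt0 ?dct_scale_gt0 ?wave0_gt0.
by rewrite unitmx_mul => /andP[].
Qed.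

Lemma superdiag_unit (R : realType) (n : nat) : 1%:M + superdiag R n \in unitmx.
Proof.
rewrite -unitmx_tr unitmxE det_trig.
  by rewrite big1 ?unitr1 // => i _;
     rewrite !mxE eqxx (ltn_eqF (ltnSn _)) addr0.
apply/is_trig_mxP => i j lt_ij; rewrite !mxE.
by rewrite -val_eqE /= gtn_eqF // ltn_eqF ?addr0 // ltnS ltnW.
Qed.

Lemma dct_diagE (R : realType) (n : nat) :
  dct_diag R n = diag_mx (\row_i (dct_scale R n i * wave R n i 0)).
Proof.
case: n => [|n]; first by apply/matrixP; case.
by congr diag_mx; apply/rowP => i; rewrite [LHS]mxE [LHS]mxE dctE mxE.
Qed.

Lemma dct_diag_unit (R : realType) (n : nat) : dct_diag R n \in unitmx.
Proof.
rewrite dct_diagE unitmxE det_diag unitfE; apply/prodf_neq0 => i _.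
have n0 := leq_ltn_trans (leq0n i) (ltn_ord i).
by rewrite mxE gt_eqF // mulr_gt0 ?dct_scale_gt0 ?wave0_gt0.
Qed.

Lemma cosmx_unit (R : realType) (n : nat) : cosmx R n \in unitmx.
Proof.
by rewrite !unitmx_mul unitmx_inv dct_diag_unit dct_unit superdiag_unit.
Qed.

(** After multiplication by W_n, column [x > 0] is the sum of columns [x] and [x - 1] of C_n. These
    are the folds of 0 + x and 0 - x, so this is [wave_fold] at [b = 0]. *)
Lemma cosmxE (R : realType) (n : nat) (i x : 'I_n) :
  cosmx R n i x = eigval R n i x.
Proof.
suff -> : cosmx R n = \matrix_(i, x) eigval R n i x by rewrite mxE.
apply: (can_inj (mulKmx (dct_diag_unit R n))).
rewrite /cosmx -mulmxA mulKVmx ?dct_diag_unit //.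
apply/matrixP => {}i {}x.
have n0 := leq_ltn_trans (leq0n i) (ltn_ord i).
rewrite dct_diagE mul_diag_mx [RHS]mxE mulmxDr mulmx1 mxE dctE !mxE.
rewrite -[RHS]mulrA -wave_fold //.
under eq_bigr do rewrite dctE mxE -mulrA.
rewrite -mulr_sumr -mulrDr add0n ltn_ord leqn0 subn0; congr (_ * _).
case: eqP => [x0|x0].
  by rewrite big1 ?addr0 ?x0 // => k _; rewrite mulr0.
have ltx1 : (x.-1 < n)%N by apply: leq_ltn_trans (ltn_ord x); exact: leq_pred.
rewrite (bigD1 (Ordinal ltx1)) //= prednK ?lt0n; last exact/eqP.
rewrite eqxx mulr1 big1 ?addr0 // => k neq_k.
have [e|_] := eqP; last by rewrite mulr0.
by case/eqP: neq_k; apply: val_inj; rewrite /= e.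
Qed.

(** * Products of Toeplitz-plus-Hankel arrays in the cosine domain *)

Lemma unitmx_comb_inj (K : fieldType) (V : lmodType K) (n : nat) (C : 'M[K]_n)
    (S T : 'I_n -> V) : C \in unitmx ->
  (forall i, \sum_a C i a *: S a = \sum_a C i a *: T a) -> S =1 T.
Proof.
move=> uC eqST.
have inv (F : 'I_n -> V) a : F a = \sum_i invmx C a i *: \sum_b C i b *: F b.
  under eq_bigr do rewrite scaler_sumr.
  rewrite exchange_big (bigD1 a) //= [X in _ + X]big1 ?addr0 => [|b neq_ba].
    under eq_bigr do rewrite scalerA.
    rewrite -scaler_suml; have /matrixP/(_ a a) := mulVmx uC.
    by rewrite !mxE eqxx => ->; rewrite scale1r.
  under eq_bigr do rewrite scalerA.
  rewrite -scaler_suml; have /matrixP/(_ a b) := mulVmx uC.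
  by rewrite !mxE eq_sym (negbTE neq_ba) => ->; rewrite scale0r.
by move=> a; rewrite (inv S) (inv T); apply: eq_bigr => i _; rewrite eqST.
Qed.

(** Row [i] of C_n, applied to the product array, passes first through [F] and then through [G],
    leaving the two eigenvalue blocks in this order. The hypothesis says that their product is the
    eigenvalue block of [H]. *)
Lemma tph_mul (R : realType) (K : fieldType) (f : {rmorphism R -> K})
    (m l p n : nat) (F : 'I_n -> 'M[K]_(m, l)) (G : 'I_n -> 'M[K]_(l, p))
    (H : 'I_n -> 'M[K]_(m, p)) :
  (forall i : 'I_n, \sum_(x < n) map_mx f (cosmx R n) i x *: H x =
     (\sum_(x < n) map_mx f (cosmx R n) i x *: F x)
     *m (\sum_(x < n) map_mx f (cosmx R n) i x *: G x)) ->
  forall a c, \sum_b tph F a b *m tph G b c = tph H a c.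
Proof.
move=> eqH a c; pose C := map_mx f (dct R n).
have uC : C \in unitmx by rewrite map_unitmx dct_unit.
have eig (V : lmodType K) (X : 'I_n -> V) i b :
    \sum_a C i a *: tph X a b
    = C i b *: \sum_(x < n) map_mx f (cosmx R n) i x *: X x.
  rewrite mxE dctE rmorphM -scalerA.
  under [in RHS]eq_bigr do rewrite [map_mx _ _ _ _]mxE cosmxE.
  rewrite -wave_eig scaler_sumr; apply: eq_bigr => k _.
  by rewrite mxE dctE rmorphM scalerA.
(* With the column [c] fixed, both sides are families in [a], and C_n separates such families. *)
move: a; apply: (unitmx_comb_inj uC) => i; rewrite eig eqH.
under eq_bigr do rewrite scaler_sumr.
rewrite exchange_big /=.
under eq_bigr => b _.
  under eq_bigr do rewrite scalemxAl.
  rewrite -mulmx_suml eig -scalemxAl scalemxAr.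
  over.
by rewrite -mulmx_sumr eig scalemxAr.
Qed.

(** * Linearity of [btph] and of mode products *)

Lemma tph_sum (K : pzRingType) (V : lmodType K) (n q : nat) (c : 'I_q -> K)
    (F : 'I_q -> 'I_n -> V) (a b : 'I_n) :
  tph (fun k => \sum_y c y *: F y k) a b = \sum_y c y *: tph (F y) a b.
Proof.
under [in RHS]eq_bigr do rewrite tph_delta scaler_sumr.
rewrite tph_delta exchange_big; apply: eq_bigr => x _.
by rewrite -sumrMnl; apply: eq_bigr => y _; rewrite scalerMnr.
Qed.

Definition tsum (K : pzRingType) (m p r : nat) (d : 'I_r -> nat) (q : nat)
    (c : 'I_q -> K) (X : 'I_q -> tensor K m p d) : tensor K m p d :=
  fun i => \sum_y c y *: X y i.

Lemma btph_tsum (K : pzRingType) (m p r : nat) (d : 'I_r -> nat) (q : nat)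
    (c : 'I_q -> K) (X : 'I_q -> tensor K m p d) :
  btph (tsum c X) = \sum_y c y *: btph (X y).
Proof.
elim: r d X => [|r IHr] d X //=; apply/matrixP => i j; rewrite summxE [LHS]mxE.
under [RHS]eq_bigr do rewrite mxE mxE.
have -> : (fun k => btph (last_slice (tsum c X) k))
    = (fun k => \sum_y c y *: btph (last_slice (X y) k)).
  by apply: funext => k; rewrite -IHr.
by rewrite tph_sum summxE; apply: eq_bigr => y _; rewrite mxE.
Qed.

Lemma mode_prod_tsum (K : comPzRingType) (m p r : nat) (d : 'I_r -> nat)
    (k : 'I_r) (U : 'M[K]_(d k)) (q : nat) (c : 'I_q -> K)
    (X : 'I_q -> tensor K m p d) :
  mode_prod U (tsum c X) = tsum c (fun y => mode_prod U (X y)).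
Proof.
apply: functional_extensionality_dep => i; rewrite /mode_prod /tsum.
under eq_bigr do rewrite scaler_sumr.
rewrite exchange_big; apply: eq_bigr => y _; rewrite scaler_sumr.
by apply: eq_bigr => x _; rewrite !scalerA mulrC.
Qed.

(** Common form of [Lop] and [Linv], over an arbitrary list of modes so that induction on the list
    applies. *)
Definition modes (K : pzRingType) (m p r : nat) (d : 'I_r -> nat)
    (U : forall k, 'M[K]_(d k)) (s : seq 'I_r) (X : tensor K m p d) :
    tensor K m p d :=
  foldl (fun Y k => mode_prod (U k) Y) X s.

Lemma modes_tsum (K : comPzRingType) (m p r : nat) (d : 'I_r -> nat)
    (U : forall k, 'M[K]_(d k)) (s : seq 'I_r) (q : nat)
    (c : 'I_q -> K) (X : 'I_q -> tensor K m p d) :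
  modes U s (tsum c X) = tsum c (fun y => modes U s (X y)).
Proof. by elim: s X => //= k s IHs X; rewrite mode_prod_tsum IHs. Qed.

(** * Slices along the last mode *)

Lemma dfwith_rcons_lift (r : nat) (d : 'I_r.+1 -> nat)
    (i : mindex (dims_init d)) (x : 'I_(d ord_max)) (k : 'I_r)
    (y : 'I_(dims_init d k)) :
  dfwith (mindex_rcons i x) (y : 'I_(d (lift ord_max k)))
  = mindex_rcons (dfwith i y) x.
Proof.
apply: functional_extensionality_dep => j.
case: (unliftP ord_max j) => [h ->|->]; last first.
  by rewrite mindex_rcons_max dfwith_out ?mindex_rcons_max // eq_sym neq_lift.
rewrite mindex_rcons_lift; have [<-|neq_kh] := eqVneq k h.
  by rewrite !dfwith_in.
rewrite !dfwith_out ?mindex_rcons_lift //.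
by apply: contra neq_kh => /eqP/lift_inj->.
Qed.

Lemma dfwith_rcons_max (r : nat) (d : 'I_r.+1 -> nat)
    (i : mindex (dims_init d)) (x y : 'I_(d ord_max)) :
  dfwith (mindex_rcons i x) y = mindex_rcons i y.
Proof.
apply: functional_extensionality_dep => j.
case: (unliftP ord_max j) => [h ->|->]; last first.
  by rewrite mindex_rcons_max dfwith_in.
by rewrite dfwith_out ?neq_lift // !mindex_rcons_lift.
Qed.

Lemma last_slice_mode_lift (K : pzRingType) (m p r : nat) (d : 'I_r.+1 -> nat)
    (k : 'I_r) (U : 'M[K]_(d (lift ord_max k))) (X : tensor K m p d)
    (x : 'I_(d ord_max)) :
  last_slice (mode_prod U X) x
  = @mode_prod K m p r (dims_init d) k U (last_slice X x).
Proof.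
apply: functional_extensionality_dep => i; rewrite /last_slice /mode_prod.
by apply: eq_bigr => y _; rewrite dfwith_rcons_lift mindex_rcons_lift.
Qed.

Lemma last_slice_mode_max (K : pzRingType) (m p r : nat) (d : 'I_r.+1 -> nat)
    (U : 'M[K]_(d ord_max)) (X : tensor K m p d) (x : 'I_(d ord_max)) :
  last_slice (mode_prod U X) x = tsum (U x) (last_slice X).
Proof.
apply: functional_extensionality_dep => i; rewrite /last_slice /mode_prod.
by apply: eq_bigr => y _; rewrite dfwith_rcons_max mindex_rcons_max.
Qed.

Lemma last_slice_modes_lift (K : pzRingType) (m p r : nat) (d : 'I_r.+1 -> nat)
    (U : forall k, 'M[K]_(d k)) (s : seq 'I_r) (X : tensor K m p d)
    (x : 'I_(d ord_max)) :
  last_slice (modes U (map (lift ord_max) s) X) x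
  = @modes K m p r (dims_init d) (fun k => U (lift ord_max k)) s
      (last_slice X x).
Proof. by elim: s X => //= k s IHs X; rewrite IHs last_slice_mode_lift. Qed.

Lemma enum_ordS_lift (r : nat) :
  enum 'I_r.+1 = rcons (map (lift ord_max) (enum 'I_r)) ord_max.
Proof.
rewrite enum_ordSr; congr rcons; apply: eq_map => k; apply: val_inj.
by rewrite /= /bump leqNgt ltn_ord.
Qed.

(** [Lop] treats the last mode last, so it combines slices already transformed in the other modes;
    linearity moves this combination inside. *)
Lemma last_slice_Lop (R : realType) (m p r : nat) (d : 'I_r.+1 -> nat)
    (X : tensor R[i] m p d) (x : 'I_(d ord_max)) :
  last_slice (Lop X) x = Lop (tsum (cosmxC R (d ord_max) x) (last_slice X)).
Proof.
rewrite [in LHS]/Lop enum_ordS_lift foldl_rcons last_slice_mode_max.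
rewrite [RHS]modes_tsum; congr tsum; apply: funext => y.
exact: last_slice_modes_lift.
Qed.

(** Here the last mode comes first, and linearity moves the combination outside. *)
Lemma last_slice_Linv (R : realType) (m p r : nat) (d : 'I_r.+1 -> nat)
    (X : tensor R[i] m p d) (x : 'I_(d ord_max)) :
  last_slice (Linv X) x
  = tsum (invmx (cosmxC R (d ord_max)) x) (fun y => Linv (last_slice X y)).
Proof.
rewrite [in LHS]/Linv enum_ordS_lift rev_rcons /= -map_rev.
rewrite [LHS](@last_slice_modes_lift _ _ _ _ _
  (fun k => invmx (cosmxC R (d k)))).
by rewrite last_slice_mode_max modes_tsum.
Qed.

(** * Induction on the number of modes *)

Lemma cosmxC_unit (R : realType) (n : nat) : cosmxC R n \in unitmx.
Proof.
by rewrite [cosmxC R n]/(map_mx (real_complex R) _) map_unitmx cosmx_unit.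
Qed.

Lemma sum_mulVmx (K : comUnitRingType) (V : lmodType K) (n : nat) (M : 'M[K]_n)
    (Z : 'I_n -> V) (i : 'I_n) : M \in unitmx ->
  \sum_x M i x *: \sum_y invmx M x y *: Z y = Z i.
Proof.
move=> uM; under eq_bigr do rewrite scaler_sumr.
rewrite exchange_big /=.
under eq_bigr => y _.
  under eq_bigr do rewrite scalerA.
  rewrite -scaler_suml.
  have /matrixP/(_ i y) := mulmxV uM; rewrite !mxE => ->.
  over.
rewrite (bigD1 i) //= eqxx scale1r big1 ?addr0 // => y.
by rewrite eq_sym => /negbTE->; rewrite scale0r.
Qed.

(** Besides the cosine formula, this shows that the product is again of the form [btph X], so that
    [ten] does not take its default value on it. *)
Lemma btph_mul (R : realType) (m l p r : nat) (d : 'I_r -> nat)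
    (A : tensor R[i] m l d) (B : tensor R[i] l p d) :
  btph A *m btph B = btph (Linv (facewise (Lop A) (Lop B))).
Proof.
elim: r d A B => [|r IHr] d A B.
  by rewrite /Linv /Lop (size0nil (size_enum_ord 0)).
rewrite /= mul_mxblock; apply: eq_mxblock => a c.
apply: (tph_mul (f := real_complex R)) => i.
under eq_bigr => x _.
  rewrite last_slice_Linv btph_tsum.
  over.
rewrite -[map_mx _ _]/(cosmxC R (d ord_max)).
(* M_n cancels the inverse contributed by [Linv] on the last mode. What remains is the induction
   hypothesis for the slices of [A] and [B] combined with row [i] of M_n. *)
rewrite sum_mulVmx ?cosmxC_unit // -!btph_tsum IHr.
by rewrite -!last_slice_Lop.
Qed.

(* MathComp world.  I k is the dimension of mode k + 3. *)
Theorem lemma1 (R : realType) (N : nat) (hN : (3 <= N)%N)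
    (I1 I2 l : nat) (I : 'I_(N - 2) -> nat)
    (hI1 : (0 < I1)%N) (hI2 : (0 < I2)%N) (hl : (0 < l)%N)
    (hI : forall k, (0 < I k)%N)
    (A : tensor R[i] I1 l I) (B : tensor R[i] l I2 I) :
  cprod A B = Linv (facewise (Lop A) (Lop B)).
Proof. by rewrite /cprod btph_mul ten_btph. Qed.
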